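(* For every integer $n\ge3$ and every integer $k\ge1$, the $k$-balanced chromatic quasisymmetric function $X_{C_n}^k$ of the cycle graph $C_n$ on $n$ vertices is symmetric, i.e., it is invariant under every permutation of the indeterminates $x_1,x_2,\dots$.
   Context: $\mathbb{P}$ denotes the positive integers. An orientation of a simple graph $G$ is a directed graph on the same vertices containing, for each edge $\{i,j\}$ of $G$, exactly one of $(i,j)$, $(j,i)$ (and no other edges). For $k\ge1$, an orientation $\mathcal{O}$ of $G$ is $k$-balanced if for every cycle of $G$ with edges $\{v_1,v_2\},\{v_2,v_3\},\dots,\{v_{r-1},v_r\},\{v_r,v_1\}$, $\mathcal{O}$ contains at least $k$ directed edges of the form $(v_i,v_{i+1})$ and at least $k$ directed edges of the form $(v_{i+1},v_i)$ (subscripts modulo $r$). A proper coloring of $G$ is a map $\kappa:V(G)\to\mathbb{P}$ with $\kappa(i)\ne\kappa(j)$ whenever $\{i,j\}$ is an edge. The orientation $\mathcal{O}_\kappa$ induced by a proper coloring $\kappa$ directs each edge toward the endpoint with the greater color; $\kappa$ is a $k$-balanced coloring if $\mathcal{O}_\kappa$ is $k$-balanced. For a finite simple graph $G$ with $V(G)=[n]$, the $k$-balanced chromatic quasisymmetric function of $G$ is the formal power series $$X_G^k=X_G^k(x_1,x_2,\dots)=\sum_{\kappa}x_{\kappa(1)}x_{\kappa(2)}\cdots x_{\kappa(n)}$$ in commuting indeterminates, summed over all $k$-balanced colorings $\kappa:V(G)\to\mathbb{P}$. *)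

(* Defs.v *)
From mathcomp Require Import all_boot all_order all_algebra.
From mathcomp Require Import finmap monalg.
From mathcomp Require Import boolp classical_sets functions cardinality fsbigop.

Set Implicit Arguments.
Unset Strict Implicit.
Unset Printing Implicit Defensive.

Local Open Scope nat_scope.

(** * Simple graphs, orientations, balancedness *)

Record sgraph (T : finType) := SGraph {
  adj :> rel T;
  adj_sym : symmetric adj;
  adj_irr : irreflexive adj }.

(* [ordS i] is i + 1 modulo n. The conjunct [i != j] is redundant as soon as
   n >= 2; it only makes [cycle_graph n] a simple graph for every n. For n >= 3
   this is the cycle on n vertices. *)
Definition cycle_adj n : rel 'I_n :=
  fun i j => (i != j) && ((j == ordS i) || (i == ordS j)).

Lemma cycle_adj_sym n : symmetric (@cycle_adj n).
Proof. by move=> i j; rewrite /cycle_adj eq_sym orbC. Qed.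

Lemma cycle_adj_irr n : irreflexive (@cycle_adj n).
Proof. by move=> i; rewrite /cycle_adj eqxx. Qed.

Definition cycle_graph n : sgraph 'I_n :=
  SGraph (@cycle_adj_sym n) (@cycle_adj_irr n).

Section Balanced.
Variables (T : finType) (G : sgraph T).
Implicit Types (O : rel T) (s : seq T) (k : nat).

Definition orientation O : Prop :=
  forall i j, if G i j then O i j != O j i else ~~ O i j.

(* A cycle of G is listed as the sequence v_1, ..., v_r of its distinct
   vertices, r >= 3, with v_i adjacent to v_(i+1) and v_r adjacent to v_1. *)
Definition graph_cycle s : bool := (2 < size s) && ucycleb G s.

(* [next s v] is the cyclic successor of v in s. *)
Definition forward_edges O s : nat := count (fun v => O v (next s v)) s.
Definition backward_edges O s : nat := count (fun v => O (next s v) v) s.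

Definition balanced k O : Prop :=
  orientation O /\
  forall s, graph_cycle s -> k <= forward_edges O s /\ k <= backward_edges O s.

End Balanced.

(** * Balanced colorings *)

Definition posint := {c : nat | 0 < c}.

Section Colorings.
Variables (T : finType) (G : sgraph T).
Implicit Types (kappa : {ffun T -> posint}).

Definition proper_coloring kappa : Prop :=
  forall i j, G i j -> kappa i != kappa j.

Definition induced_orientation kappa : rel T :=
  fun i j => G i j && (val (kappa i) < val (kappa j)).

Lemma induced_orientationP kappa :
  proper_coloring kappa -> orientation G (induced_orientation kappa).
Proof.
move=> col i j; rewrite /induced_orientation (adj_sym G j i).
case: (boolP (G i j)) => //= Gij; have := col i j Gij.
by rewrite -val_eqE /=; case: ltngtP.
Qed.

Definition balanced_coloring k kappa : Prop :=
  proper_coloring kappa /\ balanced G k (induced_orientation kappa).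

End Colorings.

(** * Formal power series in the indeterminates x_1, x_2, ... *)

Local Open Scope classical_set_scope.
Local Open Scope ring_scope.

(* A monomial [m : {cmonom posint}] maps c to the exponent of x_c; [ucm c] is
   the monomial x_c. A series maps a monomial to its coefficient. *)
Definition fpseries := {cmonom posint} -> int.

Definition monom_subst (sigma : posint -> posint) (m : {cmonom posint}) :
    {cmonom posint} :=
  \big[mmul/mone]_(c <- finsupp m) expcmn (ucm (sigma c)) (m c).

(* f(x_(sigma 1), x_(sigma 2), ...), i.e. the sum over all monomials m' of
   f m' times [monom_subst sigma m']. The sum giving a coefficient has a single
   term when sigma is bijective. *)
Definition series_subst (sigma : posint -> posint) (f : fpseries) : fpseries :=
  fun m => \sum_(m' \in [set m' | monom_subst sigma m' = m]) f m'.

Definition symmetric_series (f : fpseries) : Prop :=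
  forall sigma : posint -> posint, bijective sigma -> series_subst sigma f = f.

Definition coloring_monom (T : finType) (kappa : {ffun T -> posint}) :
    {cmonom posint} :=
  \big[mmul/mone]_(i : T) ucm (kappa i).

(* The coefficient of m is the number of k-balanced colorings with monomial m;
   the sum is genuinely finite by [finite_coloring_monom] below. *)
Definition balanced_chromatic (T : finType) (G : sgraph T) (k : nat) : fpseries :=
  fun m => \sum_(kappa \in [set kappa | balanced_coloring G k kappa])
             ((coloring_monom kappa == m)%:R : int).

Lemma coloring_monomE (T : finType) (kappa : {ffun T -> posint}) c :
  coloring_monom kappa c = #|[set i | kappa i == c]%SET|.
Proof.
rewrite /coloring_monom -sum1dep_card [RHS]big_mkcond /=.
apply: (big_ind2 (fun (m : {cmonom posint}) (k : nat) => m c = k)).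
- exact: cm1.
- by move=> m1 n1 m2 n2 <- <-; rewrite cmM.
- by move=> i _; rewrite cmU; case: eqP.
Qed.

Lemma finite_coloring_monom (T : finType) (m : {cmonom posint}) :
  finite_set [set kappa : {ffun T -> posint} | coloring_monom kappa = m].
Proof.
pose g (h : {ffun T -> finsupp m}) : {ffun T -> posint} :=
  [ffun i => val (h i)].
apply: (@sub_finite_set _ _ (g @` setT)); last first.
  by apply: finite_image; exact: finite_finset.
move=> kappa /= km.
have kin i : kappa i \in finsupp m.
  rewrite mem_finsupp -km coloring_monomE cards_eq0.
  by apply/finset.set0Pn; exists i; rewrite inE.
exists [ffun i => [` kin i]%fset] => //.
by apply/ffunP => i; rewrite !ffunE.
Qed.

Lemma expcmnE (m : {cmonom posint}) n c : expcmn m n c = (m c * n)%N.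
Proof.
case: n => [|n]; first by rewrite muln0 /expcmn /= cm1.
rewrite /expcmn iteropS; elim: n => [|n IHn]; first by rewrite muln1.
by rewrite iterS cmM IHn [RHS]mulnS.
Qed.

Lemma monom_substE sigma (m : {cmonom posint}) c :
  injective sigma -> monom_subst sigma m (sigma c) = m c.
Proof.
move=> inj; rewrite /monom_subst.
transitivity (\sum_(d <- finsupp m) (d == c) * m d)%N.
  apply: (big_ind2 (fun (m' : {cmonom posint}) (k : nat) => m' (sigma c) = k)).
  - exact: cm1.
  - by move=> m1 n1 m2 n2 <- <-; rewrite cmM.
  - by move=> d _; rewrite expcmnE cmU (inj_eq inj).
case: (boolP (c \in finsupp m)) => cm.
  rewrite (bigD1_seq c) ?fset_uniq //= eqxx mul1n big1 ?addn0 // => d.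
  by move=> /negPf->.
rewrite (fsfun_dflt cm) big1_seq // => d /= dm.
by case: eqP => // dc; rewrite -dc dm in cm.
Qed.

Lemma monom_subst_inj sigma : injective sigma -> injective (monom_subst sigma).
Proof.
move=> inj m1 m2 e; apply/eqP/cmP => c.
by rewrite -(monom_substE m1 c inj) e monom_substE.
Qed.

Lemma series_substE sigma (f : fpseries) m :
  injective sigma -> series_subst sigma f (monom_subst sigma m) = f m.
Proof.
move=> inj; rewrite /series_subst.
rewrite (_ : [set _ | _] = [set m]) ?fsbig_set1 //.
by apply/seteqP; split => [m' /= /(monom_subst_inj inj)|m' /= ->].
Qed.

(* Main.v *)
(** It suffices to compare coefficients under the exchange of two consecutive
    colors a and b = a + 1, since on the finite support of a monomial every
    bijection agrees with a product of such exchanges. Given a coloring of the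
    cycle, look at the maximal runs of vertices colored a or b, along which the
    colors alternate, and exchange a and b on the runs of odd length. Runs of
    even length contain as many a's as b's, so the content gets permuted. The
    order relation between a and b and any other color does not change, and an
    odd run has as many ascents as descents, before and after the exchange. So
    the numbers of ascents and descents around the cycle are preserved, and
    these count the forward and backward edges (or conversely) of any cycle of
    the graph, since it must go once around, in one of the two directions. *)

Require Import Defs.
From mathcomp Require Import ssralg ssrint finmap monalg.
From mathcomp Require Import boolp classical_sets functions cardinality fsbigop.
From mathcomp Require Import all_boot zify.

Set Implicit Arguments.
Unset Strict Implicit.
Unset Printing Implicit Defensive.

Local Open Scope nat_scope.

(** * Preliminaries on cyclic sequences, counting and substitution in monomials *)

Lemma uniq_next2 (U : eqType) (s : seq U) x :
  uniq s -> 2 < size s -> x \in s -> next s (next s x) != x.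
Proof.
move=> us ss /rot_to[i s' e]; rewrite -!(next_rot i us) e.
have := us; rewrite -(rot_uniq i) e.
move: ss; rewrite -(size_rot i) e; case: s' {e} => [|y [|z s']] //= _.
rewrite !inE !negb_or eqxx => /and3P[/and3P[xy xz _] _ _].
by rewrite eqxx [y == x]eq_sym (negPf xy) eq_sym.
Qed.

Lemma count_mem_all (T : finType) (P : pred T) (s : seq T) :
  uniq s -> (forall x, x \in s) -> count P s = #|[set x | P x]|.
Proof.
move=> us sT; rewrite -sum1_count -sum1dep_card; apply/perm_big/uniq_perm => //.
- exact: index_enum_uniq.
- by move=> x; rewrite sT mem_index_enum.
Qed.

Lemma monom_subst_eq sigma (m m' : {cmonom posint}) : bijective sigma ->
  (forall c, m' (sigma c) = m c) -> monom_subst sigma m = m'.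
Proof.
move=> bij mE; apply/eqP/cmP => c; have [tau _ tauK] := bij.
by rewrite -(tauK c) mE monom_substE //; apply: bij_inj.
Qed.

Lemma monom_subst_comp (s t : posint -> posint) m :
  bijective s -> bijective t ->
  monom_subst (s \o t) m = monom_subst s (monom_subst t m).
Proof.
move=> bs bt; apply: monom_subst_eq => [|c]; first exact: bij_comp.
by rewrite /= !monom_substE //; apply: bij_inj.
Qed.

(** * Lengths of runs along a single cyclic orbit *)

Section RunLength.
Variables (T : finType) (h : T -> T).
Hypothesis h_conn : forall x y, fconnect h x y.

(* The number of consecutive elements of S met from v along h; when S is the
   whole type this is the full length of the cycle. *)
Definition run_length (S : {set T}) v := find [predC S] (orbit h v).

Lemma run_length_notin (S : {set T}) v : v \notin S -> run_length S v = 0.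
Proof. by move=> vS; rewrite /run_length /orbit -orderSpred /= vS. Qed.

Lemma run_length_in (S : {set T}) v :
  S != setT -> v \in S -> run_length S v = (run_length S (h v)).+1.
Proof.
move=> SnT vS; have ord x : order h x = #|T|.
  by rewrite /order; apply: eq_card => y; rewrite [LHS]h_conn.
have [u uS] : exists u, u \notin S.
  apply/existsP; apply: contraNT SnT => /existsPn allS.
  by apply/eqP/setP => x; rewrite in_setT; apply/negPn/allS.
rewrite /run_length /orbit !ord.
case cT: #|T| => [|m]; first by move: (max_card (pred1 v)); rewrite cT card1.
rewrite [traject h (h v) m.+1]trajectSr trajectS /= vS /= -cats1 find_cat.
(* The orbits of [v] and [h v] share this stretch. As it already leaves [S], the last entry of the
   second orbit is never reached. *)
suff -> : has [predC S] (traject h (h v) m) by [].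
have := h_conn v u; rewrite fconnect_orbit /orbit ord cT /= in_cons.
case: eqP => [uv|_ /= um]; first by rewrite uv vS in uS.
by apply/hasP; exists u.
Qed.

Lemma run_length_setT v : run_length setT v = #|T|.
Proof.
rewrite /run_length hasNfind ?size_orbit; last first.
  by apply/hasPn => x _ /=; rewrite in_setT.
by rewrite /order; apply: eq_card => y; rewrite [LHS]h_conn.
Qed.

End RunLength.

(** * Parity of runs and matchings inside them *)

Section Runs.
Variables (T : finType) (f g : T -> T).
Hypotheses (fK : cancel f g) (gK : cancel g f).
Hypotheses (f_conn : forall x y, fconnect f x y).

Let f_inj : injective f := can_inj fK.
Let g_inj : injective g := can_inj gK.

Lemma fconnect_cancel x y : fconnect g x y.
Proof.
rewrite -(iter_findex (f_conn y x)).
elim: (findex f y x) => [|i IH]; first exact: connect0.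
by rewrite iterS; apply: connect_trans (fconnect1 _ _) _; rewrite fK.
Qed.
Let g_conn := fconnect_cancel.

(* Both run lengths count v, so the run through v has
   [run_length f S v + run_length g S v - 1] elements. *)
Definition odd_run (S : {set T}) v :=
  odd (run_length f S v) == odd (run_length g S v).

(** A step along [f] inside a run shortens the forward length by one and lengthens the backward one
    by one, so both parities flip. *)
Lemma odd_run_step (S : {set T}) v :
  v \in S -> f v \in S -> odd_run S (f v) = odd_run S v.
Proof.
have [->|SnT] := eqVneq S setT.
  by rewrite /odd_run !run_length_setT.
move=> vS fvS; rewrite /odd_run (run_length_in f_conn SnT vS).
by rewrite (run_length_in g_conn SnT fvS) fK /=; do 2 case: odd.
Qed.

(** For [S] proper, [run_length g S v] is the position of [v] in its run, counted from 1: odd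
    positions pair forward, even ones backward. *)
Let mate (S : {set T}) v := if odd (run_length g S v) then f v else g v.

(* J consists of the even runs, or of the tails of the edges inside odd runs:
   in both cases the positions 1, 2, 3, ... in a run can be matched as
   (1, 2), (3, 4), ... When S is the whole cycle, mate is a rotation. *)
Lemma run_matching (S J : {set T}) :
    J = [set v in S | ~~ odd_run S v] \/
    J = [set v in S | (f v \in S) && odd_run S v] ->
  exists mate : T -> T,
    {in J, forall v, mate v \in J /\ (mate v = f v \/ mate v = g v)} /\
    {in J &, injective mate}.
Proof.
have [-> HJ|SnT HJ] := eqVneq S setT.
  (* Both lengths equal [#|T|] here, so every element counts as lying in an odd run, and [J] is
     empty or everything. *)
  exists f; split=> [v|v w _ _]; last exact: f_inj.
  by case: HJ => ->; rewrite !inE /= (@odd_run_step setT v) ?inE //; auto.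
have fin v := @run_length_in _ _ f_conn S v SnT.
have gin v := @run_length_in _ _ g_conn S v SnT.
have inf v : 0 < run_length f S v -> v \in S.
  by apply: contraTT => /run_length_notin->.
have ing v : 0 < run_length g S v -> v \in S.
  by apply: contraTT => /run_length_notin->.
suff H : {in J, forall v, mate S v \in J /\ mate S (mate S v) = v}.
  exists (mate S); split=> [v vJ|v w vJ wJ e]; last first.
    by rewrite -(H v vJ).2 e (H w wJ).2.
  by split; [have [] := H v vJ | rewrite /mate; case: ifP; auto].
have mateK v : v \in S -> mate S v \in S -> mate S (mate S v) = v.
  move=> vS; rewrite /mate; case od: (odd (run_length g S v)) => /= mS.
    by rewrite (gin _ mS) fK /= od.
  by move: od; rewrite (gin _ vS) /= => /negbFE ->; rewrite gK.
move=> v vJ; have vS : v \in S by case: HJ vJ => ->; rewrite inE => /andP[].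
suff mJ : mate S v \in J.
  by split=> //; apply: mateK => //; case: HJ mJ => ->; rewrite inE => /andP[].
case: HJ vJ => ->; rewrite !inE => /andP[_].
  rewrite /mate; case: ifP => od nodd.
    have fvS : f v \in S.
      apply: inf; move: nodd; rewrite /odd_run od (fin _ vS) /=.
      by case: run_length.
    by rewrite fvS odd_run_step.
  have gvS : g v \in S.
    by apply: ing; move: od; rewrite (gin _ vS) /=; case: run_length.
  by have := odd_run_step gvS; rewrite gvS gK => /(_ vS) <-.
case/andP=> fvS oddr; rewrite /mate; case: ifP => od.
  rewrite fvS odd_run_step // oddr andbT /=; apply: inf.
  move: oddr; rewrite /odd_run od (fin _ vS) (fin _ fvS) /=.
  by case: run_length.
have gvS : g v \in S.
  by apply: ing; move: od; rewrite (gin _ vS) /=; case: run_length.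
by have := odd_run_step gvS; rewrite gvS gK vS => /(_ isT) <-.
Qed.

(** The matching stays in [J] and moves to a neighbor, hence to the other of the two colors. It
    injects each color class of [J] into the other. *)
Lemma run_balance (C : eqType) (c : T -> C) (x y : C) (S J : {set T}) :
    (forall v, c v != c (f v)) -> (forall v, (v \in S) = (c v \in [:: x; y])) ->
    J = [set v in S | ~~ odd_run S v] \/
    J = [set v in S | (f v \in S) && odd_run S v] ->
  #|[set v in J | c v == x]| = #|[set v in J | c v == y]|.
Proof.
move=> c_proper SE HJ; have [m [mJ m_inj]] := run_matching HJ.
have JS v : v \in J -> v \in S by case: HJ => ->; rewrite inE => /andP[].
have le a b : (forall v, (v \in S) = (c v \in [:: a; b])) ->
    #|[set v in J | c v == a]| <= #|[set v in J | c v == b]|.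
  move=> abE; rewrite -(@card_in_imset _ _ m) => [|v w]; last first.
    by rewrite !inE => /andP[vJ _] /andP[wJ _]; apply: m_inj.
  apply/subset_leq_card/subsetP => _ /imsetP[v + ->].
  rewrite !inE => /andP[vJ /eqP cv]; have [mvJ mv] := mJ v vJ.
  rewrite mvJ /=; have : c (m v) != c v.
    case: mv => ->; first by rewrite eq_sym.
    by have := c_proper (g v); rewrite gK.
  by have := JS _ mvJ; rewrite abE !inE cv => /orP[/eqP->|//]; rewrite eqxx.
by apply/eqP; rewrite eqn_leq !le // => v; rewrite SE !inE orbC.
Qed.

(** A closed walk through more than two distinct vertices cannot turn back ([uniq_next2]), so its
    first step fixes the direction of all others. *)
Lemma next_everywhere (s : seq T) x0 :
    uniq s -> 2 < size s -> x0 \in s -> next s x0 = f x0 ->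
    {in s, forall x, next s x = f x \/ next s x = g x} ->
  forall v, v \in s /\ next s v = f v.
Proof.
move=> us ss x0s e0 fg v; rewrite -(iter_findex (f_conn x0 v)).
elim: (findex _ _ _) => [|i [IHs IHe]] //=; set w := iter _ _ _ in IHs IHe *.
have fws : f w \in s by rewrite -IHe mem_next.
split=> //; case: (fg _ fws) => // /eqP.
by rewrite fK -{1}IHe (negPf (uniq_next2 us ss IHs)).
Qed.

End Runs.

(** * Transpositions of two colors *)

Section Transposition.
Variables (C : eqType) (x y : C).

Definition transp (c : C) := if c == x then y else if c == y then x else c.

Lemma transpL : transp x = y.
Proof. by rewrite /transp eqxx. Qed.

Lemma transpR : transp y = x.
Proof. by rewrite /transp eqxx; case: eqP. Qed.

Lemma transpD c : c \notin [:: x; y] -> transp c = c.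
Proof. by rewrite !inE negb_or /transp => /andP[/negPf-> /negPf->]. Qed.

Lemma transpK : involutive transp.
Proof.
move=> c; have [|/transpD E] := boolP (c \in [:: x; y]); last by rewrite !E.
by rewrite !inE => /orP[]/eqP->; rewrite ?(transpL, transpR).
Qed.

Lemma mem_transp c : (transp c \in [:: x; y]) = (c \in [:: x; y]).
Proof.
have [|cD] := boolP (c \in [:: x; y]); last by rewrite transpD ?(negPf cD).
by rewrite !inE => /orP[]/eqP->; rewrite ?(transpL, transpR) eqxx ?orbT.
Qed.

End Transposition.

Lemma transpC (C : eqType) (x y : C) : transp x y =1 transp y x.
Proof. by move=> c; rewrite /transp; case: eqP => [->|_]; case: eqP => // ->. Qed.

Lemma transp_conj (C : eqType) (x y z : C) : x != z -> y != z -> x != y ->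
  transp x z =1 transp x y \o transp y z \o transp x y.
Proof.
move=> xz yz xy c /=.
have D (u v w : C) : w != u -> w != v -> transp u v w = w.
  by move=> wu wv; rewrite transpD // !inE negb_or wu wv.
have [yx zx zy] : [/\ y != x, z != x & z != y].
  by rewrite [y == x]eq_sym ![z == _]eq_sym.
have [->|cx] := eqVneq c x; first by rewrite !transpL D.
have [->|cy] := eqVneq c y; first by rewrite transpR [transp y z x]D // transpL D.
have [->|cz] := eqVneq c z; first by rewrite [transp x y z]D // !transpR.
by rewrite !D.
Qed.

(** * The recoloring involution and what it preserves *)

Section Recolor.
Variables (T : finType) (f g : T -> T).
Hypotheses (fK : cancel f g) (gK : cancel g f).
Hypotheses (f_conn : forall x y, fconnect f x y).
Variables (a b : posint).
Hypothesis ab : val b = (val a).+1.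
Implicit Types kappa : {ffun T -> posint}.

Let lt_abE :
  (((val a < val b) = true) * ((val b < val a) = false)) *
  (((a == b) = false) * ((b == a) = false)).
Proof.
have lt : val a < val b by rewrite ab.
by rewrite -!(inj_eq val_inj) lt (ltn_eqF lt) (gtn_eqF lt) ltnNge ltnW.
Qed.

Definition two_colored kappa := [set v | kappa v \in [:: a; b]].

(** Off [two_colored] both run lengths are 0 and [odd_run] holds; this is harmless, since
    [transp a b] fixes the colors there. *)
Definition recolor kappa : {ffun T -> posint} :=
  [ffun v => if odd_run f g (two_colored kappa) v
             then transp a b (kappa v) else kappa v].

Lemma two_colored_recolor kappa : two_colored (recolor kappa) = two_colored kappa.
Proof.
apply/setP => v; rewrite [LHS]inE [RHS]inE ffunE.
by case: ifP => // _; rewrite mem_transp.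
Qed.

(** Recoloring keeps the set of vertices colored [a] or [b], hence the runs and their parities, so
    the same swaps are performed again. *)
Lemma recolorK : involutive recolor.
Proof.
move=> kappa; apply/ffunP => v; rewrite ffunE two_colored_recolor ffunE.
by case: odd_run; rewrite ?transpK.
Qed.

(** No third color lies between the consecutive colors [a] and [b]. *)
Lemma transp_ltl (c d : posint) : c \notin [:: a; b] ->
  (val (transp a b d) < val c) = (val d < val c).
Proof.
rewrite !inE -!val_eqE negb_or /transp -!val_eqE => /andP[/eqP ca /eqP cb].
by case: eqP => [->|_]; [|case: eqP => [->|_] //]; move: ab ca cb;
  move: (val a) (val b) (val c); lia.
Qed.

Lemma transp_ltr (c d : posint) : c \notin [:: a; b] ->
  (val c < val (transp a b d)) = (val c < val d).
Proof.
rewrite !inE -!val_eqE negb_or /transp -!val_eqE => /andP[/eqP ca /eqP cb].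
by case: eqP => [->|_]; [|case: eqP => [->|_] //]; move: ab ca cb;
  move: (val a) (val b) (val c); lia.
Qed.

Definition ascents kappa := [set v | val (kappa v) < val (kappa (f v))].
Definition descents kappa := [set v | val (kappa (f v)) < val (kappa v)].

Lemma descentsE kappa :
  (forall v, kappa v != kappa (f v)) -> descents kappa = ~: ascents kappa.
Proof.
move=> kp; apply/setP => v; have := kp v.
by rewrite !inE -val_eqE /=; case: ltngtP.
Qed.

Let odd_edges kappa :=
  [set v in two_colored kappa |
    (f v \in two_colored kappa) && odd_run f g (two_colored kappa) v].

Lemma recolor_lt kappa v : v \notin odd_edges kappa ->
  (val (recolor kappa v) < val (recolor kappa (f v))) =
  (val (kappa v) < val (kappa (f v))).
Proof.
rewrite !ffunE inE; set S := two_colored kappa.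
have inS w : (w \in S) = (kappa w \in [:: a; b]) by rewrite [LHS]inE.
have [vS|vS _] := boolP (v \in S); last first.
  rewrite (transpD (c := kappa v)) -?inS // if_same.
  by case: ifP => // _; rewrite transp_ltr -?inS.
have [fvS|fvS _] := boolP (f v \in S); last first.
  rewrite (transpD (c := kappa (f v))) -?inS // if_same.
  by case: ifP => // _; rewrite transp_ltl -?inS.
by rewrite (odd_run_step fK f_conn) //= => /negPf->.
Qed.

(** Only edges inside odd runs can change direction. Among these, the ascents have tail colored [a]
    before and [b] after (in terms of the old colors), and [run_balance] equates the two counts. *)
Lemma recolor_card_ascents kappa : (forall v, kappa v != kappa (f v)) ->
  #|ascents (recolor kappa)| = #|ascents kappa|.
Proof.
move=> kp; rewrite -(cardsID (odd_edges kappa)).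
rewrite -[RHS](cardsID (odd_edges kappa)); congr (_ + _); last first.
  apply: eq_card => v; rewrite [LHS]inE [RHS]inE.
  by case: (boolP (v \in odd_edges kappa)) => //= vO; rewrite !inE recolor_lt.
have two v : v \in odd_edges kappa ->
    kappa v = a /\ kappa (f v) = b \/ kappa v = b /\ kappa (f v) = a.
  rewrite !inE => /and3P[/orP[]/eqP kv /orP[]/eqP kfv _];
  by have := kp v; rewrite kv kfv ?eqxx //; auto.
transitivity #|[set v in odd_edges kappa | kappa v == b]|.
  apply: eq_card => v; rewrite [LHS]inE [RHS]inE andbC.
  case: (boolP (v \in odd_edges kappa)) => //= vO.
  have := vO; rewrite inE => /and3P[vS fvS odv].
  rewrite inE !ffunE (odd_run_step fK f_conn) // odv.
  by case: (two v vO) => -[-> ->]; rewrite ?(transpL, transpR) !lt_abE ?eqxx.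
transitivity #|[set v in odd_edges kappa | kappa v == a]|.
  symmetry; apply: (run_balance fK gK f_conn kp) => [v|]; last by right.
  by rewrite [LHS]inE.
apply: eq_card => v; rewrite [LHS]inE [RHS]inE [RHS]andbC.
case: (boolP (v \in odd_edges kappa)) => //= vO.
by rewrite inE; case: (two v vO) => -[-> ->]; rewrite !lt_abE ?eqxx.
Qed.

Lemma recolor_proper kappa :
  (forall v, kappa v != kappa (f v)) ->
  forall v, recolor kappa v != recolor kappa (f v).
Proof.
move=> kp v; rewrite !ffunE; set S := two_colored kappa.
have inS w : (w \in S) = (kappa w \in [:: a; b]) by rewrite [LHS]inE.
have E w w' : w \in S -> w' \notin S -> transp a b (kappa w) != kappa w'.
  by rewrite !inS => wS; apply: contraNneq => <-; rewrite mem_transp.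
have [vS|vS] := boolP (v \in S); have [fvS|fvS] := boolP (f v \in S).
- rewrite (odd_run_step fK f_conn) //; case: ifP => // _.
  by rewrite (inj_eq (inv_inj (transpK a b))).
- rewrite (transpD (c := kappa (f v))) -?inS // if_same.
  by case: ifP => // _; apply: E.
- rewrite (transpD (c := kappa v)) -?inS // if_same eq_sym.
  by case: ifP => // _; [apply: E | rewrite eq_sym].
- by rewrite !(transpD (x := a) (y := b)) -?inS // !if_same.
Qed.

(** On even runs nothing moves, but [a] and [b] occur equally often there; everywhere else the
    recoloring amounts to applying [transp a b]. *)
Lemma recolor_card_color kappa c : (forall v, kappa v != kappa (f v)) ->
  #|[set v | recolor kappa v == transp a b c]| = #|[set v | kappa v == c]|.
Proof.
move=> kp; set S := two_colored kappa.
have inS w : (w \in S) = (kappa w \in [:: a; b]) by rewrite [LHS]inE.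
pose even := [set v in S | ~~ odd_run f g S v].
have evenE v : (v \in even) = (v \in S) && ~~ odd_run f g S v by rewrite [LHS]inE.
have E : #|[set v in even | kappa v == transp a b c]| =
         #|[set v in even | kappa v == c]|.
  have bal := run_balance fK gK f_conn kp inS (or_introl (erefl even)).
  have [|/transpD -> //] := boolP (c \in [:: a; b]).
  by rewrite !inE => /orP[]/eqP ->; rewrite ?(transpL, transpR).
rewrite -(cardsID even) -[RHS](cardsID even); congr (_ + _).
  transitivity #|[set v in even | kappa v == transp a b c]|; last first.
    by rewrite E; apply: eq_card => v; rewrite [LHS]inE [RHS]inE andbC inE.
  apply: eq_card => v; rewrite [LHS]inE [RHS]inE andbC.
  case: (boolP (v \in even)) => //=; rewrite evenE => /andP[_ nodd].
  by rewrite !inE ffunE (negPf nodd).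
apply: eq_card => v; rewrite [LHS]inE [RHS]inE evenE.
rewrite [v \in [set v | kappa v == c]]inE [X in _ && X]inE ffunE -/S.
have [_|od] := boolP (odd_run f g S v).
  by rewrite (inj_eq (inv_inj (transpK a b))).
have [//|vS] := boolP (v \in S).
have kD : transp a b (kappa v) = kappa v by rewrite transpD // -inS.
by rewrite -{1}kD (inj_eq (inv_inj (transpK a b))).
Qed.

Lemma recolor_monom kappa : (forall v, kappa v != kappa (f v)) ->
  coloring_monom (recolor kappa) = monom_subst (transp a b) (coloring_monom kappa).
Proof.
move=> kp; symmetry; apply: monom_subst_eq => [|c]; first exact: inv_bij (transpK a b).
by rewrite !coloring_monomE recolor_card_color.
Qed.

End Recolor.

(** * Cycles of the cycle graph and invariance under adjacent transpositions *)

Section CycleGraph.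
Variables (n : nat) (n_ge3 : 3 <= n).

Lemma val_iter_ordS j (i : 'I_n) : val (iter j (@ordS n) i) = (i + j) %% n.
Proof.
elim: j => [|j IHj]; first by rewrite addn0 modn_small.
by rewrite iterS /= [nat_of_ord _]IHj -addn1 modnDml addn1 addnS.
Qed.

Lemma ordS_connect (i j : 'I_n) : fconnect (@ordS n) i j.
Proof.
(* Go from [i] up to [n], that is to 0 modulo [n], then on to [j]. *)
suff -> : j = iter (j + (n - i)) (@ordS n) i by apply: fconnect_iter.
apply: val_inj; rewrite val_iter_ordS addnC -addnA subnK ?(ltnW (ltn_ord i)) //.
by rewrite modnDr modn_small.
Qed.

Lemma ordS_neq (i : 'I_n) : i != ordS i.
Proof.
rewrite -val_eqE /=; have := ltn_ord i; rewrite leq_eqVlt => /orP[/eqP e|lt].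
  by rewrite e modnn -lt0n; move: n_ge3; rewrite -[X in 2 < X]e ltnS; apply: ltn_trans.
by rewrite modn_small // neq_ltn ltnSn.
Qed.

Lemma cycle_graph_ordS (i : 'I_n) : cycle_graph n i (ordS i).
Proof. by rewrite /= /cycle_adj ordS_neq eqxx. Qed.

Lemma cycle_graph_next (s : seq 'I_n) : graph_cycle (cycle_graph n) s ->
  (forall v, v \in s /\ next s v = ordS v) \/
  (forall v, v \in s /\ next s v = ord_pred v).
Proof.
case/andP=> ss /andP[cs us].
have fg : {in s, forall x, next s x = ordS x \/ next s x = ord_pred x}.
  move=> x /(next_cycle cs) /andP[_ /orP[]/eqP e]; first by left.
  by right; rewrite [in RHS]e ordSK.
case: s ss cs us fg => // x0 s ss cs us fg; have x0s := mem_head x0 s.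
have [e|e] := fg x0 x0s.
  by left; apply: (next_everywhere (@ordSK n) ordS_connect us ss x0s e fg).
right; apply: (next_everywhere (@ord_predK n) _ us ss x0s e).
  exact: (fconnect_cancel (@ordSK n) ordS_connect).
by move=> x /fg[]; auto.
Qed.

(** The disjunction stands outside the quantifier on [O]: the direction depends on [s] alone, so a
    coloring and its recoloring fall under the same case. *)
Lemma cycle_graph_edges (s : seq 'I_n) : graph_cycle (cycle_graph n) s ->
  let up (O : rel 'I_n) := #|[set v | O v (ordS v)]| in
  let down (O : rel 'I_n) := #|[set v | O (ordS v) v]| in
  (forall O, forward_edges O s = up O /\ backward_edges O s = down O) \/
  (forall O, forward_edges O s = down O /\ backward_edges O s = up O).
Proof.
move=> cs up down; have us : uniq s by case/andP: cs => _ /andP[].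
(* Walking backwards lists each edge from its upper end; this shift lists it from the lower one. *)
have reindex (P : pred 'I_n) : #|[set v | P (ord_pred v)]| = #|[set v | P v]|.
  rewrite -(card_imset _ (can_inj (@ord_predK n))); apply: eq_card => v.
  rewrite -{1}(ordSK v) mem_imset; last exact: can_inj (@ord_predK n).
  by rewrite !inE ordSK.
case: (cycle_graph_next cs) => H; [left | right] => O;
  rewrite /forward_edges /backward_edges !count_mem_all //;
  try (by move=> x; have [] := H x).
  by split; apply: eq_card => v; rewrite !inE (H v).2.
rewrite /up /down -(reindex (fun v => O v (ordS v))).
rewrite -(reindex (fun v => O (ordS v) v)).
by split; apply: eq_card => v; rewrite !inE (H v).2 ord_predK.
Qed.

Lemma card_induced_up (kappa : {ffun 'I_n -> posint}) :
  #|[set v | induced_orientation (cycle_graph n) kappa v (ordS v)]| =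
  #|ascents (@ordS n) kappa|.
Proof.
by apply: eq_card => v; rewrite !inE /induced_orientation cycle_graph_ordS.
Qed.

Lemma card_induced_down (kappa : {ffun 'I_n -> posint}) :
  #|[set v | induced_orientation (cycle_graph n) kappa (ordS v) v]| =
  #|descents (@ordS n) kappa|.
Proof.
apply: eq_card => v.
by rewrite !inE /induced_orientation adj_sym cycle_graph_ordS.
Qed.

Lemma proper_cycle_coloring (kappa : {ffun 'I_n -> posint}) :
  proper_coloring (cycle_graph n) kappa <->
  forall v, kappa v != kappa (ordS v).
Proof.
split=> [kp v|kp i j]; first exact: kp (cycle_graph_ordS v).
by case/andP=> _ /orP[]/eqP->; rewrite // eq_sym.
Qed.

Section Recoloring.
Variables (a b : posint) (k : nat).
Hypothesis ab : val b = (val a).+1.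

Let recol := @recolor _ (@ordS n) (@ord_pred n) a b.
Let B := [set kappa | balanced_coloring (cycle_graph n) k kappa]%classic.

Lemma balanced_recolor kappa : B kappa -> B (recol kappa).
Proof.
case=> /proper_cycle_coloring kp [_ kB].
have rp := recolor_proper (@ordSK n) ordS_connect a b kp.
have up := recolor_card_ascents (@ordSK n) (@ord_predK n) ordS_connect ab kp.
have down : #|descents (@ordS n) (recol kappa)| = #|descents (@ordS n) kappa|.
  by rewrite !descentsE // cardsCs [RHS]cardsCs !setCK up.
have rpG := (proper_cycle_coloring _).2 rp.
split=> //; split=> [|s cs]; first exact: induced_orientationP.
have := kB s cs.
by case: (cycle_graph_edges cs) => H; rewrite !(H _).1 !(H _).2
  !card_induced_up !card_induced_down up down.
Qed.

(** [recolor] permutes the balanced colorings and acts on their monomials as [transp a b], so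
    reindexing the sum by it gives the claim. *)
Lemma balanced_chromatic_transp m :
  balanced_chromatic (cycle_graph n) k (monom_subst (transp a b) m) =
  balanced_chromatic (cycle_graph n) k m.
Proof.
have rK := recolorK (@ordS n) (@ord_pred n) a b.
have tinj := bij_inj (inv_bij (transpK a b)).
have rB : set_bij B B recol.
  split=> [kappa|kappa kappa' _ _|kappa Bk]; first exact: balanced_recolor.
    exact: (can_inj rK).
  by exists (recol kappa); [apply: balanced_recolor | apply: rK].
rewrite /balanced_chromatic (reindex_fsbig _ _ _ _ rB).
apply: eq_fsbigr => kappa /set_mem [/proper_cycle_coloring kp _].
rewrite (recolor_monom (@ordSK n) (@ord_predK n) ordS_connect) //.
by rewrite (inj_eq (monom_subst_inj tinj)).
Qed.

End Recoloring.
End CycleGraph.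

(** * From adjacent transpositions to all bijections of the colors *)

Section Symmetric.
Variable f : fpseries.

Definition fixes_series (sigma : posint -> posint) :=
  bijective sigma /\ forall m, f (monom_subst sigma m) = f m.

Lemma fixes_series_comp s t :
  fixes_series s -> fixes_series t -> fixes_series (s \o t).
Proof.
move=> [bs fs] [bt ft]; split=> [|m]; first exact: bij_comp.
by rewrite monom_subst_comp // fs ft.
Qed.

Lemma symmetric_series_transp :
    (forall a b : posint, val b = (val a).+1 ->
       forall m, f (monom_subst (transp a b) m) = f m) ->
  symmetric_series f.
Proof.
move=> adj.
have eq_fix s t : s =1 t -> fixes_series s -> fixes_series t.
  by move=> st; have <- : s = t by apply/funext.
have fix_id : fixes_series id.
  split=> [|m]; first by exists id.
  by congr f; apply: monom_subst_eq => //; exists id.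
have fix_adj a b : val b = (val a).+1 -> fixes_series (transp a b).
  by move=> ab; split; [apply: inv_bij (transpK a b) | apply: adj].
(* Induction on the number [d] of colors strictly between [a] and [b], conjugating by the exchange
   of [a] with its successor. *)
have fix_lt d (a b : posint) : val b = (val a + d).+1 -> fixes_series (transp a b).
  elim: d a => [|d IHd] a ab; first by apply: fix_adj; rewrite ab addn0.
  pose a' : posint := exist _ (val a).+1 isT.
  have aa' : val a' = (val a).+1 by [].
  have a'b : val b = (val a' + d).+1 by rewrite ab aa' addnS.
  have ne (x y : posint) : val x < val y -> x != y.
    by move=> lt; rewrite -val_eqE ltn_eqF.
  apply: (@eq_fix (transp a a' \o transp a' b \o transp a a')).
    move=> c; rewrite -transp_conj // ne // ?a'b ?ab ?aa' ?ltnS ?leq_addr //.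
    by rewrite addSn -addnS leq_addr.
  by apply: fixes_series_comp; [apply: fixes_series_comp|]; auto.
have fix_transp a b : fixes_series (transp a b).
  have [ab|ba|/val_inj <-] := ltngtP (val a) (val b).
  - by apply: (fix_lt (val b - (val a).+1)); rewrite -addSn subnKC.
  - apply: (eq_fix (transp b a)); first exact: transpC.
    by apply: (fix_lt (val a - (val b).+1)); rewrite -addSn subnKC.
  - by apply: eq_fix fix_id => c; rewrite /transp; case: eqP => [->|].
(* A monomial only sees sigma on its finite support, where sigma agrees with a
   product of transpositions. *)
have fix_agree (sigma : posint -> posint) (s : seq posint) : injective sigma ->
    uniq s -> exists2 w, fixes_series w & {in s, w =1 sigma}.
  move=> s_inj; elim: s => [_|c s IHs /= /andP[cs us]].
    by exists id.
  have [w fw wE] := IHs us.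
  (* This corrects the value at [c]. For [d] in [s], [w d] equals [sigma d] and differs from both
     [w c] and [sigma c] by injectivity, so it is kept. *)
  exists (transp (w c) (sigma c) \o w); first exact: fixes_series_comp.
  move=> d; rewrite in_cons => /orP[/eqP->|ds] /=; first by rewrite transpL.
  have dc : d != c by apply: contraNneq cs => <-.
  have w_inj : injective w by case: fw => /bij_inj.
  rewrite transpD; first exact: wE.
  by rewrite !inE negb_or (inj_eq w_inj) dc (wE d ds) (inj_eq s_inj) dc.
move=> sigma s_bij; apply/funext => m'; have [tau sK tK] := s_bij.
have s_inj := bij_inj s_bij.
(* Writing the monomial as an image under [sigma] reduces its coefficient to a single one of [f]. *)
have -> : m' = monom_subst sigma (monom_subst tau m').
  rewrite -monom_subst_comp //; last by exists sigma.
  by apply/esym/monom_subst_eq => [|c] /=; [exists id => c /=; rewrite tK | rewrite tK].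
move: (monom_subst tau m') => m {m'}; rewrite series_substE //.
have [w [_ fw] wE] := fix_agree sigma _ s_inj (fset_uniq (finsupp m)).
rewrite -[LHS]fw; congr f; apply: eq_big_seq => c cm.
by rewrite wE.
Qed.

End Symmetric.

Theorem proposition4p2 (n k : nat) (hn : 3 <= n) (hk : 1 <= k) :
  symmetric_series (balanced_chromatic (cycle_graph n) k).
Proof.
apply: symmetric_series_transp => a b ab m.
exact: balanced_chromatic_transp.
Qed.
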